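(* For any dimension $(d-1)$, the $d-1$ limit roots, i.e. the roots of the polynomial $p_d(t)$ defined in the context, are invariant under the map $x\mapsto \frac{-x}{x+1}$.
   Context: For a finite simplicial complex $X$ of dimension $d-1$, $f^X_i$ is the number of $i$-dimensional faces of $X$, with $f^X_{-1}=1$ (the empty face), and the $f$-polynomial of $X$ is $f^X(t)=\sum_{j=0}^d f^X_{j-1}t^{d-j}$. $X^{(n)}$ denotes the $n$-th iterated barycentric subdivision of $X$. For $i,j\ge -1$, $\lambda_{i,j}$ is the number of $j$-dimensional faces in the interior of the first barycentric subdivision of the standard $i$-dimensional simplex, where by convention $\lambda_{i,-1}$ is $1$ if $i=-1$ and $0$ otherwise (and $\lambda_{i,j}=0$ if $j>i$). $\Lambda_d=[\lambda_{i,j}]_{-1\le i,j\le d-1}$ is the resulting $(d+1)\times(d+1)$ matrix; it is lower triangular with eigenvalues $0!,1!,\dots,d!$. Write $\Lambda_d=P_dD_dP_d^{-1}$, where $D_d$ is the diagonal matrix with entries $0!,1!,\dots,d!$ and $P_d$ is the lower triangular diagonalizing matrix of eigenvectors. With rows and columns of $P_d^{-1}$ indexed by $0,\dots,d$, put $p_d(t)=\sum_{k=0}^{d}(P_d^{-1})_{d,k}\,t^{d-k}$, the polynomial whose coefficients are listed in the last row of $P_d^{-1}$. The limit roots are the $d-1$ values to which the $d-1$ largest roots of $f^{X^{(n)}}(t)$ converge as $n$ grows, for $X$ a $(d-1)$-dimensional simplicial complex (the one remaining root diverges to $-\infty$). These values depend only on $d$, not on $X$, and they are the roots of $p_d(t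)$.
   Formalization: For d ≥ 2, the value -1 is always a limit root and the map is undefined there, so invariance is stated on the projective line for the d-1 limit roots together with infinity (limit of the diverging root), -1 and infinity being exchanged; the degenerate d = 1 is excluded. *)

(* Defs.v *)
From HB Require Import structures.
From mathcomp Require Import all_boot all_order all_algebra.
Set Implicit Arguments.
Unset Strict Implicit.
Unset Printing Implicit Defensive.
Import Order.TTheory GRing.Theory Num.Theory.
Local Open Scope ring_scope.

(* A finite simplicial complex is given by the set K of its faces, each face   *)
(* being its set of vertices; a face with m vertices has dimension m - 1.      *)
(* A face of the barycentric subdivision is a set of nonempty faces of K that  *)
(* is totally ordered by inclusion.                                            *)
Definition barycentric_sd (T : finType) (K : {set {set T}}) :
    {set {set {set T}}} :=
  [set c : {set {set T}} | (c \subset K :\ set0) &&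
     [forall A in c, forall B in c, (A \subset B) || (B \subset A)]].

(* The simplex with m vertices, of dimension m - 1.                            *)
Definition simplex (m : nat) : {set {set 'I_m}} := [set: {set 'I_m}].

Definition simplex_boundary (m : nat) : {set {set 'I_m}} :=
  [set A : {set 'I_m} | A \proper [set: 'I_m]].

(* Indices are shifted by one: lambda i j is $\lambda_{i-1,j-1}$, so that both *)
(* arguments count vertices. The first branch is the convention for the empty  *)
(* face. A face of the subdivided simplex is interior when it is not a face of *)
(* the subdivided boundary.                                                    *)
Definition lambda (i j : nat) : nat :=
  if j == 0%N then (i == 0%N : nat)
  else #|[set c in barycentric_sd (simplex i)
                   :\: barycentric_sd (simplex_boundary i) | #|c| == j]|.

Definition Lambda (R : nzRingType) (d : nat) : 'M[R]_d.+1 :=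
  \matrix_(i < d.+1, j < d.+1) (lambda i j)%:R.

Definition fact_diag (R : nzRingType) (d : nat) : 'M[R]_d.+1 :=
  diag_mx (\row_(i < d.+1) (i`!)%:R).

(* is_trig_mx means lower triangular. The matrix P is not unique, but for      *)
(* d >= 2 the last row of its inverse is a left eigenvector for the simple     *)
(* eigenvalue d!, hence is unique up to a nonzero scalar.                      *)
Definition diagonalizing (F : fieldType) (d : nat) (P : 'M[F]_d.+1) : Prop :=
  [/\ is_trig_mx P, P \in unitmx
    & Lambda F d = P *m fact_diag F d *m invmx P].

Definition limit_poly (F : fieldType) (d : nat) (P : 'M[F]_d.+1) : {poly F} :=
  \sum_(k < d.+1) invmx P ord_max k *: 'X^(d - k).

(* The entries of s are the roots of p, repeated according to multiplicity.    *)
Definition root_seq (F : fieldType) (p : {poly F}) (s : seq F) : Prop :=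
  p != 0 /\ p = lead_coef p *: \prod_(z <- s) ('X - z%:P).

(* The map x |-> - x / (x + 1) on the projective line, None being the point at *)
(* infinity; it exchanges -1 and infinity.                                     *)
Definition mobius (F : fieldType) (x : option F) : option F :=
  match x with
  | Some z => if z == -1 then None else Some (- z / (z + 1))
  | None => Some (-1)
  end.

(* The limits of all d roots: the finite ones, and infinity once for the root  *)
(* that diverges. Since -1 is always a limit root, and is sent to infinity by  *)
(* the map, invariance only makes sense with infinity included.                *)
Definition extended_roots (F : fieldType) (s : seq F) : seq (option F) :=
  None :: [seq Some z | z <- s].

(* Main.v *)
Require Import Defs.
From HB Require Import structures.
From mathcomp Require Import all_boot all_order all_algebra ring.
Set Implicit Arguments.
Unset Strict Implicit.
Unset Printing Implicit Defensive.
Import Order.TTheory GRing.Theory Num.Theory.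
Local Open Scope ring_scope.

(** Give the last row v of the inverse of P the generating polynomial
    q(x) = sum_k v_k x^k.  The limit polynomial is its reversal t^d q(1/t), and
    in the coordinate 1/t the map t |-> -t/(t+1) becomes the affine reflection
    x |-> -1 - x.  So the claim is that the roots of q are symmetric about -1/2,
    the root 0 of q standing for the root of the f-polynomials that diverges.

    The symmetry has a conceptual source.  A face of the barycentric subdivision
    of a simplex is a chain of faces, and it is interior when the chain reaches
    the top; counting such chains amounts to counting surjections, so that
    sum_j lambda i j * C(n, j) = n^i (lemma [sum_chains_onto_bin]).  Thus Lambda
    expresses the powers x^i in the basis of the binomial polynomials C(x, j),
    and v being a left eigenvector of Lambda for d! says that q = d! phi(q),
    where phi is the linear map [to_binomial], x^j |-> C(x, j)
    ([Lambda_eigen_binomial]).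
    By the Vandermonde identity phi commutes with the substitution
    x |-> -1 - x ([to_binomial_reflect]).  As phi multiplies the coefficient of
    degree e of a polynomial of degree e by 1/e!, and d! differs from e! for
    e < d, a solution of q = d! phi(q) of degree at most d is determined by its
    coefficient of degree d; comparing these coefficients gives
    q(-1-x) = (-1)^d q(x) ([eigen_binomial_reflect]).

    It remains to know that exactly one root escapes to infinity, i.e. that q
    has a simple root at 0: v_0 = 0 and v_1 <> 0.  In column 0 the equation
    v Lambda = d! v reads v_0 = d! v_0.  For v_1, solve it by descending index:
    Lambda is triangular with nonnegative entries and diagonal j!, so, once v_d
    is normalized to 1, all v_j are nonnegative, and v_1 is positive
    ([Lambda_eigen_coef1_gt0]). *)

(** * Chains of faces and surjections *)

Section Chains.
Local Open Scope nat_scope.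
Variable T : finType.
Implicit Types (A B : {set T}) (c : {set {set T}}).

(** A nonempty chain has a largest member, which is its union; prescribing the
    union [cover c] instead of the largest member also covers the empty chain,
    whose union is [set0], in agreement with the convention for the empty
    face. *)
Definition chains_onto A j : {set {set {set T}}} :=
  [set c in barycentric_sd [set: {set T}] | (cover c == A) && (#|c| == j)].

Lemma barycentric_sdP (K : {set {set T}}) c :
  reflect [/\ c \subset K, set0 \notin c
            & {in c &, forall A B, (A \subset B) || (B \subset A)}]
          (c \in barycentric_sd K).
Proof.
rewrite inE subsetD1 -andbA.
apply: (iffP and3P) => [[-> -> /forall_inP h]|[-> -> h]]; split=> //.
  by move=> A B /h /forall_inP/(_ B).
by apply/forall_inP => A cA; apply/forall_inP => B; apply: h.
Qed.

(** A member of maximal cardinality contains all the others. *)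
Lemma cover_in_chain K c :
  c \in barycentric_sd K -> c != set0 -> cover c \in c.
Proof.
case/barycentric_sdP=> _ _ chain_c /set0Pn[A0 cA0].
case: (@arg_maxnP _ A0 (mem c) (fun A => #|A|) cA0) => A cA maxA.
suff -> : cover c = A by [].
apply/eqP; rewrite eqEsubset bigcup_sup // andbT.
apply/bigcupsP=> B cB; case/orP: (chain_c A B cA cB) => // sAB.
by rewrite (eqP (_ : A == B)) // eqEcard sAB; apply: maxA.
Qed.

Lemma in_chains_onto A j c :
  (c \in chains_onto A j) =
    [&& c \in barycentric_sd [set: {set T}], cover c == A & #|c| == j].
Proof. by rewrite in_set. Qed.

Lemma chains_onto0 A : #|chains_onto A 0| = (A == set0).
Proof.
have in0 : set0 \in barycentric_sd [set: {set T}].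
  by apply/barycentric_sdP; split=> [||B C]; rewrite ?sub0set ?inE.
case: (A =P set0) => [->|/eqP nA0] /=; last first.
  apply: eq_card0 => c; rewrite in_chains_onto cards_eq0 [RHS]inE.
  apply/negP=> /and3P[_ h /eqP c0].
  by move: nA0; rewrite -(eqP h) c0 /cover big_set0 eqxx.
rewrite -(cards1 (set0 : {set {set T}})); apply: eq_card => c.
rewrite in_chains_onto cards_eq0 [RHS]inE.
apply/and3P/eqP => [[_ _ /eqP] //|->].
by rewrite in0 /cover big_set0.
Qed.

Lemma sub_barycentric_sd K c c' :
  c' \subset c -> c \in barycentric_sd K -> c' \in barycentric_sd K.
Proof.
move=> /subsetP sc /barycentric_sdP[/subsetP sK n0 ch]; apply/barycentric_sdP.
split; first by apply/subsetP => A /sc/sK.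
  by apply: contra n0 => /sc.
by move=> A B /sc cA /sc cB; apply: ch.
Qed.

Lemma cover_setD1_proper K c :
  c \in barycentric_sd K -> c != set0 ->
  cover (c :\ cover c) \proper cover c.
Proof.
move=> Kc c0; have topc := cover_in_chain Kc c0.
have Kc' := sub_barycentric_sd (subsetDl c [set cover c]) Kc.
rewrite properEneq; apply/andP; split; last first.
  by apply/bigcupsP=> B /setD1P[_ cB]; apply: bigcup_sup.
have [e|/(cover_in_chain Kc')] := eqVneq (c :\ cover c) set0.
  rewrite e /cover big_set0.
  by apply: contraNneq (_ : set0 \notin c) => [->|]; case/barycentric_sdP: Kc.
by case/setD1P => ->.
Qed.

(** Removing the largest member [A] of a chain leaves a chain with a smaller
    union [B]; conversely [A] can be put on top of any chain with union [B]. *)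
Lemma card_chains_ontoS A j :
  #|chains_onto A j.+1| = \sum_(B : {set T} | B \proper A) #|chains_onto B j|.
Proof.
rewrite -sum1_card.
rewrite (partition_big (fun c => cover (c :\ A)) (fun B => B \proper A)).
  apply: eq_bigr => B /= BA; rewrite -sum1_card.
  rewrite (reindex_onto (fun c => A |: c) (fun c => c :\ A)) => [|c] /=.
    apply: eq_bigl => c; rewrite !in_chains_onto.
    apply/idP/idP.
      case/andP=> [/andP[/and3P[sdc _ cj] cB] /eqP e].
      rewrite e in cB; rewrite cB (sub_barycentric_sd (subsetUr _ _) sdc) /=.
      by move: cj; rewrite cardsU1 -{1}e !inE eqxx eqSS.
    case/and3P=> sdc /eqP cB /eqP cj.
    have subB C : C \in c -> C \subset B.
      by rewrite -cB => cC; apply: bigcup_sup.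
    have nA : A \notin c.
      by apply: contraL BA => /subB; rewrite properE => ->; rewrite andbF.
    rewrite setU1K // cB cardsU1 nA cj !eqxx !andbT /cover big_setU1 //=.
    move: cB; rewrite /cover => ->.
    rewrite (setUidPl (proper_sub BA)) eqxx andbT.
    case/barycentric_sdP: sdc => _ n0 ch; apply/barycentric_sdP; split.
    - by apply/subsetP => C _; rewrite inE.
    - rewrite !inE negb_or n0 andbT; apply: contraTneq BA => <-.
      by rewrite properE sub0set andbF.
    - move=> C D /setU1P[->|cC] /setU1P[->|cD].
      + by rewrite subxx.
      + by rewrite (subset_trans (subB _ cD) (proper_sub BA)) orbT.
      + by rewrite (subset_trans (subB _ cC) (proper_sub BA)).
      + exact: ch.
  rewrite in_chains_onto => /andP[/and3P[sdc /eqP cA cj] _]; rewrite setD1K //.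
  by rewrite -{1}cA (cover_in_chain sdc) // -card_gt0 (eqP cj).
move=> c; rewrite in_chains_onto => /and3P[sdc /eqP cA cj] /=.
by rewrite -cA (cover_setD1_proper sdc) // -card_gt0 (eqP cj).
Qed.

Lemma sum_powerset_exp A n :
  \sum_(B : {set T} | B \subset A) n ^ #|B| = n.+1 ^ #|A|.
Proof.
rewrite -add1n expnDn.
rewrite (partition_big (fun B : {set T} => inord #|B| : 'I_#|A|.+1) predT) //=.
apply: eq_bigr => i _; rewrite exp1n mul1n -cards_draws -sum_nat_const.
apply: eq_big => [B|B /andP[sBA /eqP <-]]; last first.
  by rewrite inordK // ltnS subset_leq_card.
rewrite inE; have [sBA|] := boolP (B \subset A) => //=.
by rewrite -val_eqE /= inordK // ltnS subset_leq_card.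
Qed.

(** Both sides agree at [n = 0], and have the same increment from [n] to
    [n.+1]: deleting the largest member turns the increment of the left side
    into the sum of [n ^ #|B|] over the proper subsets [B] of [A].  The bound
    [N] is arbitrary because no chain has more than [#|A|] members. *)
Lemma sum_chains_onto_bin A N n :
  #|A| < N -> \sum_(j < N) #|chains_onto A j| * 'C(n, j) = n ^ #|A|.
Proof.
elim: n A N => [|n IHn] A [//|N]; rewrite ltnS => leAN.
  rewrite big_ord_recl big1 => [|j _]; last by rewrite bin0n muln0.
  rewrite chains_onto0 bin0 muln1 addn0 -cards_eq0.
  by case: #|A| => // k; rewrite exp0n.
rewrite big_ord_recl bin0.
under eq_bigr => j _ do rewrite /bump /= binS mulnDr.
rewrite big_split addnA /= -[X in _ * X](bin0 n).
have := IHn A N.+1 leAN; rewrite big_ord_recl /= => ->.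
rewrite -sum_powerset_exp [RHS](bigD1 A) //=; congr (_ + _).
under eq_bigr => j _ do rewrite card_chains_ontoS big_distrl.
rewrite exchange_big /=; apply: eq_big => [B|B BA].
  by rewrite properEneq andbC.
by rewrite IHn // (leq_trans (proper_card BA)).
Qed.

Lemma chains_onto_small A j : #|A| < j -> #|chains_onto A j| = 0.
Proof.
elim: j A => // j IHj A; rewrite ltnS => leAj.
rewrite card_chains_ontoS big1 // => B /proper_card BA.
by rewrite IHj // (leq_trans BA).
Qed.

Lemma chains_onto_fact A : #|chains_onto A #|A| | = #|A|`!.
Proof.
move eq_n : #|A| => n; elim: n A eq_n => [|n IHn] A eq_n.
  by rewrite chains_onto0 -cards_eq0 eq_n.
rewrite card_chains_ontoS factS -[n.+1 in RHS]binSn -eq_n.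
rewrite -cards_draws -sum_nat_const.
(* A proper subset with fewer than n elements carries no chain of length n. *)
rewrite (bigID (fun B : {set T} => #|B| == n)) /= [X in _ + X]big1 ?addn0.
  apply: eq_big => [B|B /andP[_ /eqP/IHn]//].
  rewrite inE properEcard eq_n.
  by have [->|] := eqVneq #|B| n; rewrite ?ltnSn ?andbT ?andbF.
move=> B /andP[/proper_card]; rewrite eq_n ltnS leq_eqVlt.
case/orP=> [/eqP->|ltBn _].
  by rewrite eqxx.
exact: chains_onto_small.
Qed.

End Chains.

(** A face of the subdivided simplex lies on the boundary unless it has the
    whole simplex as a member, that is, as its union. *)
Lemma lambdaE i j : lambda i j = #|chains_onto [set: 'I_i] j|.
Proof.
rewrite /lambda; case: eqP => [->|/eqP j0].
  by rewrite chains_onto0 -cards_eq0 cardsT card_ord.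
apply: eq_card => c; rewrite in_chains_onto in_set in_setD -/(simplex i) !andbA.
have [cj|_] := eqVneq #|c| j; rewrite ?andbF // !andbT andbC.
have [sdc /=|//] := boolP (c \in barycentric_sd (simplex i)).
have c0 : c != set0 by rewrite -card_gt0 cj lt0n.
have [cT|cT] := eqVneq (cover c) setT; last apply/negbTE; rewrite ?negbK.
  apply/negP=> /[dup] /cover_in_chain/(_ c0) topc.
  case/barycentric_sdP=> /subsetP sK _ _.
  by have := sK _ topc; rewrite inE cT properE subxx.
case/barycentric_sdP: sdc => _ n0 ch; apply/barycentric_sdP; split=> //.
apply/subsetP => B cB; rewrite inE; apply: sub_proper_trans (bigcup_sup B cB) _.
by rewrite properT.
Qed.

Lemma lambda_1 i : (0 < i)%N -> lambda i 1 = 1%N.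
Proof.
move=> i_gt0; have pT : set0 \proper [set: 'I_i].
  by rewrite properT eq_sym -cards_eq0 cardsT card_ord -lt0n.
rewrite lambdaE card_chains_ontoS (bigD1 set0) //= chains_onto0 eqxx big1 //.
by move=> B /andP[_ /negbTE nB0]; rewrite chains_onto0 nB0.
Qed.

(** * The map sending powers to binomial polynomials *)

Section BinomialBasis.
Variable F : numFieldType.
Implicit Types p q : {poly F}.

Lemma poly_nat_ext p q : (forall n : nat, p.[n%:R] = q.[n%:R]) -> p = q.
Proof.
move=> eq_pq; apply/eqP; rewrite -subr_eq0; apply: contraT => nz.
have /(max_poly_roots nz) :
    all (root (p - q)) [seq n%:R | n <- iota 0 (size (p - q))].
  by apply/allP=> x /mapP[n _ ->]; rewrite /root hornerD hornerN eq_pq subrr.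
rewrite map_inj_uniq ?iota_uniq ?size_map ?size_iota ?ltnn => [|m n /eqP].
  exact.
by rewrite eqr_nat => /eqP.
Qed.

(** The binomial coefficient C(x, j) as a polynomial in x. *)
Definition bin_poly j : {poly F} :=
  (j`!)%:R^-1 *: \prod_(i < j) ('X - (i%:R)%:P).

Lemma horner_bin_poly j n : (bin_poly j).[n%:R] = 'C(n, j)%:R.
Proof.
rewrite /bin_poly hornerZ; apply: (canLR (mulKf _)).
  by rewrite pnatr_eq0 -lt0n fact_gt0.
rewrite -natrM mulnC bin_ffact horner_prod.
elim: j => [|j IHj]; first by rewrite big_ord0.
rewrite big_ord_recr IHj ffactnSr natrM /= !hornerE.
have [le_jn|lt_nj] := leqP j n; first by rewrite natrB.
by rewrite ffact_small // !mul0r.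
Qed.

Lemma size_bin_poly j : (size (bin_poly j) <= j.+1)%N.
Proof.
apply: leq_trans (size_scale_leq _ _) _.
by rewrite size_prod_XsubC /index_enum -enumT size_enum_ord.
Qed.

Lemma coef_bin_poly j : (bin_poly j)`_j = (j`!)%:R^-1.
Proof.
have mon : \prod_(i < j) ('X - (i%:R)%:P : {poly F}) \is monic.
  exact: monic_prod_XsubC.
rewrite coefZ; move: mon; rewrite monicE lead_coefE size_prod_XsubC.
by rewrite /index_enum -enumT size_enum_ord => /eqP->; rewrite mulr1.
Qed.

(** The negation rule C(-1 - n, j) = (-1)^j C(n + j, j). *)
Lemma horner_bin_poly_reflect j n :
  (bin_poly j).[-1 - n%:R] = (-1) ^+ j * 'C(n + j, j)%:R.
Proof.
rewrite /bin_poly hornerZ; apply: (canLR (mulKf _)).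
  by rewrite pnatr_eq0 -lt0n fact_gt0.
rewrite mulrCA -natrM mulnC bin_ffact horner_prod.
elim: j => [|j IHj]; first by rewrite big_ord0 mulr1.
rewrite big_ord_recr IHj addnS ffactSS exprS /= !hornerE natrM.
by rewrite -natr1 natrD; ring.
Qed.

Definition to_binomial p : {poly F} := \sum_(k < size p) p`_k *: bin_poly k.

Lemma to_binomialE N p : (size p <= N)%N ->
  to_binomial p = \sum_(k < N) p`_k *: bin_poly k.
Proof.
move=> lepN; rewrite /to_binomial.
rewrite (big_ord_widen _ (fun k => p`_k *: bin_poly k) lepN).
rewrite big_mkcond; apply: eq_bigr => k _; case: ltnP => // lepk.
by rewrite nth_default // scale0r.
Qed.

Fact to_binomial_is_linear : linear to_binomial.
Proof.
move=> a p q; pose N := maxn (size p) (size q).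
have leN : (size (a *: p + q)%R <= N)%N.
  rewrite (leq_trans (size_polyD _ _)) // geq_max !leq_max size_scale_leq.
  by rewrite leqnn orbT.
rewrite (to_binomialE leN) !(@to_binomialE N) ?leq_maxl ?leq_maxr //.
rewrite [X in _ = X + _]scaler_sumr -big_split /=.
by apply: eq_bigr => k _; rewrite coefD coefZ scalerDl scalerA.
Qed.

HB.instance Definition _ :=
  GRing.isLinear.Build F {poly F} {poly F} _ to_binomial to_binomial_is_linear.

Lemma to_binomialXn j : to_binomial 'X^j = bin_poly j.
Proof.
rewrite /to_binomial size_polyXn (bigD1 ord_max) //= coefXn eqxx scale1r.
rewrite big1 ?addr0 // => k; rewrite -val_eqE /= => /negbTE nk.
by rewrite coefXn nk scale0r.
Qed.

Definition reflect_poly p := p \Po (-1 - 'X).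

(** On ['X^j] both sides are (-1)^j times the polynomial C(x + j, j): on the
    right since C(-1 - x, j) = (-1)^j C(x + j, j), on the left by expanding
    (1 + x)^j and summing with the Vandermonde identity. *)
Lemma to_binomial_reflect p :
  to_binomial (reflect_poly p) = reflect_poly (to_binomial p).
Proof.
suff X j : to_binomial (reflect_poly 'X^j) = reflect_poly (bin_poly j).
  have defp : p = \sum_(k < size p) p`_k *: 'X^k by rewrite -poly_def coefK.
  rewrite /reflect_poly [in LHS]defp.
  rewrite raddf_sum /= raddf_sum /to_binomial raddf_sum.
  by apply: eq_bigr => k _; rewrite /= comp_polyZ linearZ /= X comp_polyZ.
apply: poly_nat_ext => n; rewrite /reflect_poly horner_comp.
have -> : (-1 - 'X).[n%:R] = -1 - n%:R :> F by rewrite !hornerE.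
rewrite horner_bin_poly_reflect comp_Xn_poly.
have -> : (-1 - 'X) ^+ j =
    \sum_(k < j.+1) ((-1) ^+ j * 'C(j, k)%:R) *: 'X^k :> {poly F}.
  rewrite -opprD [LHS]exprNn exprDn mulr_sumr; apply: eq_bigr => k _.
  rewrite expr1n mul1r -scaler_nat -scalerA -[RHS]mul_polyC.
  by rewrite polyC_exp polyCN.
rewrite linear_sum horner_sum -binomial.Vandermonde natr_sum mulr_sumr.
apply: eq_bigr => k _.
rewrite linearZ /= to_binomialXn hornerZ horner_bin_poly.
by rewrite mulnC natrM mulrA bin_sub // -ltnS.
Qed.

End BinomialBasis.

(** * Eigenpolynomials and their symmetry *)

(** For [d >= 2] the eigenvalue d! is simple; 0! = 1! is the exception. *)
Lemma ltn_fact_top e d : (2 <= d)%N -> (e < d)%N -> (e`! < d`!)%N.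
Proof.
move=> d_gt1; case: e => [_|e]; first exact: (@ltn_fact 1).
exact: ltn_fact.
Qed.

Section Eigenpolynomials.
Variables (F : numFieldType) (d : nat).
Hypothesis d_ge2 : (2 <= d)%N.
Implicit Type q : {poly F}.

Definition eigen_binomial q := q = (d`!)%:R *: to_binomial q.

(** The map is triangular: only the top power contributes to the top degree. *)
Lemma coef_to_binomial_top q e :
  (size q <= e.+1)%N -> (to_binomial q)`_e = q`_e / (e`!)%:R.
Proof.
move=> leqe; rewrite (to_binomialE leqe) big_ord_recr coefD coefZ coef_bin_poly.
rewrite coef_sum big1 ?add0r // => k _.
rewrite coefZ [X in _ * X]nth_default ?mulr0 //.
exact: leq_trans (size_bin_poly _ _) (ltn_ord k).
Qed.

(** A leading coefficient c in degree e would satisfy c = (d! / e!) c. *)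
Lemma eigen_binomial_eq0 q : eigen_binomial q -> (size q <= d)%N -> q = 0.
Proof.
move=> eig led; apply/eqP; apply: contraT => nz; pose e := (size q).-1.
have szq : size q = e.+1 by rewrite prednK // lt0n size_poly_eq0.
have lte : (e < d)%N by rewrite -szq.
have := congr1 (fun p : {poly F} => p`_e) (eig : q = _).
rewrite coefZ coef_to_binomial_top ?szq // => eq_lead.
have fact_neq0 : (e`!)%:R != 0 :> F by rewrite pnatr_eq0 -lt0n fact_gt0.
have /eqP : q`_e * ((d`!)%:R - (e`!)%:R) = 0.
  by rewrite mulrBr {2}eq_lead -mulrA divfK // mulrC subrr.
rewrite mulf_eq0 subr_eq0 eqr_nat gtn_eqF ?ltn_fact_top // orbF.
by rewrite -[q`_e]/(lead_coef q) lead_coef_eq0 (negbTE nz).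
Qed.

(** Both sides are eigenpolynomials with the same coefficient of degree [d], so
    their difference is an eigenpolynomial of smaller degree. *)
Lemma eigen_binomial_reflect q :
  eigen_binomial q -> (size q <= d.+1)%N -> reflect_poly q = (-1) ^+ d *: q.
Proof.
move=> eig lesz.
have eig_r : eigen_binomial (reflect_poly q).
  by rewrite /eigen_binomial to_binomial_reflect -comp_polyZ -(eig : q = _).
have eig_s : eigen_binomial ((-1) ^+ d *: q).
  rewrite /eigen_binomial [to_binomial _]linearZ /= scalerA mulrC -scalerA.
  by rewrite -(eig : q = _).
apply/eqP; rewrite -subr_eq0; apply/eqP/eigen_binomial_eq0.
  rewrite /eigen_binomial [to_binomial _]linearB /= [RHS]scalerBr.
  by rewrite -(eig_r : _ = _) -(eig_s : _ = _).
have sz2 : size (-1 - 'X : {poly F})%R = 2%N.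
  by rewrite -opprD size_polyN addrC -polyC1 size_XaddC.
have szr : size (reflect_poly q) = size q by rewrite size_comp_poly2.
apply/leq_sizeP => j ledj; rewrite coefB coefZ.
have [ltqj|leqj] := leqP (size q) j.
  by rewrite !nth_default ?szr // mulr0 subr0.
have szq : size q = j.+1.
  by apply/eqP; rewrite eqn_leq leqj andbT (leq_trans lesz).
have eq_jd : j = d by apply/eqP; rewrite eqn_leq ledj andbT -ltnS -szq.
have := lead_coef_comp q (_ : (1 < size (-1 - 'X : {poly F})%R)%N).
rewrite sz2 => /(_ isT); rewrite !lead_coefE -/(reflect_poly q) szr sz2 szq /=.
rewrite coefB coefN coef1 coefX /= => ->.
by rewrite eq_jd oppr0 sub0r mulrC subrr.
Qed.

End Eigenpolynomials.

(** * Left eigenvectors of Lambda *)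

Section LambdaEigenvector.
Variables (F : numFieldType) (d : nat) (v : 'rV[F]_d.+1).
Hypotheses (d_ge2 : (2 <= d)%N)
           (eig_v : v *m Lambda F d = (d`!)%:R *: v).

(** Evaluated at a natural number, the eigenvector equation paired with the
    vector of the C(n, j) is the equation of eigenpolynomials. *)
Lemma Lambda_eigen_binomial : eigen_binomial d (rVpoly v).
Proof.
have sz : (size (rVpoly v) <= d.+1)%N by apply: size_poly.
apply: poly_nat_ext => n; rewrite (to_binomialE sz) (horner_coef_wide _ sz).
rewrite scaler_sumr horner_sum.
under [RHS]eq_bigr => j _.
  rewrite scalerA coef_rVpoly_ord.
  rewrite (_ : _ * _ = (v *m Lambda F d) 0 j); last by rewrite eig_v mxE.
  rewrite mxE hornerZ horner_bin_poly mulr_suml.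
  over.
rewrite exchange_big; apply: eq_bigr => k _ /=; rewrite coef_rVpoly_ord.
under eq_bigr => j _ do rewrite mxE lambdaE -mulrA -natrM.
rewrite -mulr_sumr -natr_sum sum_chains_onto_bin ?cardsT ?card_ord //.
by rewrite natrX.
Qed.

(** The [j]-th coordinate of [eig_v], with the diagonal term moved to the left:
    [lambda k j] vanishes for [k < j], and [lambda j j] is [j`!]. *)
Lemma Lambda_eigen_recurrence (j : 'I_d.+1) :
  v 0 j * ((d`!)%:R - (j`!)%:R) =
  \sum_(k < d.+1 | (j < k)%N) v 0 k * (lambda k j)%:R.
Proof.
have := congr1 (fun w : 'rV_d.+1 => w 0 j) eig_v.
rewrite !mxE mulrC mulrBr => <-.
rewrite (bigID (fun k : 'I_d.+1 => (j < k)%N)) /= -addrA.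
rewrite [X in _ + X](_ : _ = 0) ?addr0.
  by apply: eq_bigr => k _; rewrite mxE.
rewrite (bigD1 j) ?ltnn //= mxE lambdaE -[X in chains_onto _ X]card_ord -cardsT.
rewrite chains_onto_fact big1 ?addr0 ?cardsT ?card_ord ?subrr // => k.
rewrite -leqNgt => /andP[lekj nkj].
rewrite mxE lambdaE chains_onto_small ?mulr0 //.
by rewrite cardsT card_ord ltn_neqAle lekj andbT.
Qed.

(** A nonempty simplex has no interior face without vertices, so all terms of
    the recurrence vanish for [j = 0]. *)
Lemma Lambda_eigen_coef0 : v 0 0 = 0.
Proof.
have /eqP := Lambda_eigen_recurrence 0; rewrite big1 => [|k k_gt0]; last first.
  by rewrite lambdaE chains_onto0 -cards_eq0 cardsT card_ord gtn_eqF // mulr0.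
rewrite mulf_eq0 => /orP[/eqP //|].
by rewrite subr_eq0 eqr_nat gtn_eqF // ltn_fact_top // ltnW.
Qed.

(** By descending induction: in the recurrence the right side involves larger
    indices only, and d! - j! is positive for j < d. *)
Lemma Lambda_eigen_ge0 (j : 'I_d.+1) : 0 <= v 0 ord_max -> 0 <= v 0 j.
Proof.
move=> top_ge0; have [m lemj] := ubnP (d - j).
elim: m j lemj => // m IHm j lejm.
have [ltjd|ledj] := ltnP j d; last first.
  rewrite (_ : j = ord_max) //; apply: val_inj; apply/eqP.
  by rewrite /= eqn_leq ledj -ltnS ltn_ord.
have gap : 0 < (d`!)%:R - (j`!)%:R :> F.
  by rewrite subr_gt0 ltr_nat ltn_fact_top.
rewrite -(pmulr_lge0 _ gap) Lambda_eigen_recurrence sumr_ge0 // => k ltjk.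
by rewrite mulr_ge0 ?ler0n // IHm // (leq_trans (ltn_sub2l ltjd ltjk)).
Qed.

(** The term [k = d] of the recurrence is [v 0 ord_max], since [lambda d 1] is
    1, and the others are nonnegative. *)
Lemma Lambda_eigen_coef1_gt0 (j : 'I_d.+1) :
  j = 1%N :> nat -> 0 < v 0 ord_max -> 0 < v 0 j.
Proof.
move=> j1 top_gt0.
have gap : 0 < (d`!)%:R - (j`!)%:R :> F.
  by rewrite subr_gt0 ltr_nat ltn_fact_top // j1.
rewrite -(pmulr_lgt0 _ gap) Lambda_eigen_recurrence (bigD1 ord_max) /= ?j1 //.
rewrite lambda_1 ?(ltnW d_ge2) // mulr1 ltr_wpDr // sumr_ge0 // => k _.
by rewrite mulr_ge0 ?ler0n // Lambda_eigen_ge0 // ltW.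
Qed.

End LambdaEigenvector.

(** * Limit roots in the coordinate 1/t *)

Section ReversedRoots.
Variable F : numFieldType.

(** The coordinate 1/t on the projective line minus the point [Some 0]; it
    turns [mobius] into the reflection x |-> -1 - x. *)
Definition inv_coord (x : option F) : F := if x is Some z then z^-1 else 0.

Definition of_inv_coord (r : F) : option F :=
  if r == 0 then None else Some r^-1.

Lemma inv_coordK x : x != Some 0 -> of_inv_coord (inv_coord x) = x.
Proof.
rewrite /of_inv_coord; case: x => [z|_] /=; last by rewrite eqxx.
by rewrite (inj_eq Some_inj) invr_eq0 => /negbTE->; rewrite invrK.
Qed.

Lemma mobius_neq0 x : x != Some 0 -> @mobius F x != Some 0.
Proof.
case: x => [z|_] /=; last by rewrite (inj_eq Some_inj) oppr_eq0 oner_eq0.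
rewrite (inj_eq Some_inj) => z0; case: ifP => // /negbT z1.
by rewrite (inj_eq Some_inj) mulf_neq0 ?oppr_eq0 // invr_eq0 addr_eq0.
Qed.

Lemma inv_coord_mobius x :
  x != Some 0 -> inv_coord (@mobius F x) = -1 - inv_coord x.
Proof.
case: x => [z|_] /=; last by rewrite invrN1 subr0.
rewrite (inj_eq Some_inj) => z0; case: eqP => [->|/eqP z1] /=.
  by rewrite invrN1 subrr.
by rewrite -addr_eq0 in z1; field; rewrite z0 z1.
Qed.

Variable d : nat.
Implicit Type v : 'rV[F]_d.+1.

Definition reverse_poly v : {poly F} := \sum_(k < d.+1) v 0 k *: 'X^(d - k).

Lemma coef_reverse_poly v (i : 'I_d.+1) : (reverse_poly v)`_i = v 0 (rev_ord i).
Proof.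
have led (k : 'I_d.+1) : (k <= d)%N by rewrite -ltnS.
rewrite /reverse_poly coef_sum (bigD1 (rev_ord i)) //= big1 => [|k].
  by rewrite addr0 coefZ coefXn subSS subKn // eqxx mulr1.
rewrite coefZ coefXn -val_eqE /= subSS => nk.
rewrite (_ : (_ == _) = false) ?mulr0 //; apply: contraNF nk => /eqP->.
by rewrite subKn.
Qed.

(** Exactly one root is lost in the reversal: [v 0 0] is the coefficient of
    degree [d], and the entry of index 1 that of degree [d.-1]. *)
Lemma size_reverse_poly v (j : 'I_d.+1) :
  v 0 0 = 0 -> j = 1%N :> nat -> v 0 j != 0 -> size (reverse_poly v) = d.
Proof.
move=> v0 j1 vj; have d_gt0 : (0 < d)%N by rewrite -ltnS -[X in (X < _)%N]j1.
apply/eqP; rewrite eqn_leq; apply/andP; split.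
  apply/leq_sizeP => k; rewrite leq_eqVlt => /orP[/eqP <-|ltdk].
    have := coef_reverse_poly v ord_max; rewrite /= => ->.
    by rewrite (_ : rev_ord _ = 0) //; apply: val_inj; rewrite /= subnn.
  rewrite /reverse_poly coef_sum big1 // => i _.
  by rewrite coefZ coefXn gtn_eqF ?mulr0 // (leq_ltn_trans (leq_subr _ _)).
rewrite leqNgt; apply: contra vj => lt_size.
have := coef_reverse_poly v (rev_ord j); rewrite rev_ordK => <-.
by rewrite nth_default //= j1 subSS subn1 -ltnS prednK.
Qed.

Lemma horner_reverse_poly v x : x != 0 ->
  (rVpoly v).[x] = x ^+ d * (reverse_poly v).[x^-1].
Proof.
move=> x0; have sz : (size (rVpoly v) <= d.+1)%N by apply: size_poly.
rewrite (horner_coef_wide _ sz).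
rewrite /reverse_poly horner_sum mulr_sumr; apply: eq_bigr => k _.
have led : (k <= d)%N by rewrite -ltnS.
rewrite coef_rVpoly_ord hornerZ hornerXn mulrCA exprVn.
by rewrite -exprB ?unitfE ?subKn ?leq_subr.
Qed.

(** Reversing a polynomial inverts its roots.  The root 0 of [rVpoly v], lost in
    the reversal, is the one coming from the point at infinity. *)
Lemma rVpoly_extended_roots v (s : seq F) :
  v 0 0 = 0 -> v 0 ord_max != 0 -> d = (size s).+1 ->
  reverse_poly v = lead_coef (reverse_poly v) *: \prod_(z <- s) ('X - z%:P) ->
  rVpoly v =
    v 0 ord_max *: \prod_(x <- extended_roots s) ('X - (inv_coord x)%:P)
  /\ 0 \notin s.
Proof.
set c := lead_coef _ => v0 vd sz_s eq_p.
(* Evaluation at 0, where the entry of index d is the constant coefficient. *)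
have eq_vd : v 0 ord_max = c * \prod_(z <- s) (- z).
  have -> : ord_max = rev_ord 0 :> 'I_d.+1.
    by apply: val_inj; rewrite /= subSS subn0.
  rewrite -coef_reverse_poly -horner_coef0 eq_p hornerZ horner_prod.
  by congr (_ * _); apply: eq_bigr => z _; rewrite !hornerE.
have s_neq0 : 0 \notin s.
  by apply: contra vd => s0; rewrite eq_vd (big_rem 0) //= oppr0 mul0r mulr0.
split=> //; apply: poly_nat_ext => n.
rewrite big_cons big_map hornerZ hornerM horner_prod /=.
have [->|n_gt0] := posnP n.
  rewrite horner_coef0 (coef_rVpoly_ord v 0) v0.
  by rewrite hornerXsubC subr0 mul0r mulr0.
set x : F := n%:R; have x0 : x != 0 by rewrite /x pnatr_eq0 -lt0n.
move: x x0 => x x0; rewrite horner_reverse_poly // eq_p hornerZ horner_prod.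
rewrite eq_vd sz_s exprS.
have -> : x ^+ size s = \prod_(z <- s) x.
  by rewrite big_const_seq count_predT iter_mulr_1.
rewrite hornerXsubC subr0 mulrACA [RHS]mulrACA [x * c]mulrC.
congr (_ * _); rewrite -!big_split /=.
apply: eq_big_seq => z sz; have z0 : z != 0 by apply: contraNneq s_neq0 => <-.
by rewrite !hornerXsubC; field; rewrite z0.
Qed.

End ReversedRoots.

(** Unique factorization turns a symmetry of a split polynomial into a symmetry
    of its roots, multiplicities included. *)
Lemma perm_reflected_roots (F : numFieldType) (c : F) (r : seq F) :
  let q := c *: \prod_(x <- r) ('X - x%:P) in
  c != 0 -> reflect_poly q = (-1) ^+ size r *: q ->
  perm_eq [seq -1 - x | x <- r] r.
Proof.
move=> q c0 sym; apply: prod_XsubC_eq; rewrite big_map.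
apply: (scalerI c0); apply: (scalerI (_ : (-1) ^+ size r != 0)).
  by rewrite expf_neq0 // oppr_eq0 oner_eq0.
rewrite -/q -[RHS]sym /q /reflect_poly comp_polyZ scalerA mulrC -scalerA.
congr (_ *: _); elim: r {q sym} => [|x r IHr].
  by rewrite !big_nil scale1r comp_polyC.
rewrite !big_cons comp_polyM -IHr exprS comp_polyB comp_polyX comp_polyC.
rewrite -scalerAr [-1 * _]mulrC -scalerA scaleN1r -mulNr.
congr (_ *: (_ * _)).
by rewrite opprB polyCB polyCN addrAC.
Qed.

(** From P^-1 Lambda = D P^-1, whose last diagonal entry is d!. *)
Lemma last_row_eigen (F : numFieldType) (d : nat) (P : 'M[F]_d.+1) :
  diagonalizing P ->
  row ord_max (invmx P) *m Lambda F d = (d`!)%:R *: row ord_max (invmx P).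
Proof.
case=> _ uP ->; rewrite !mulmxA -row_mul mulVmx // -row_mul mul1mx -row_mul.
by apply/rowP => j; rewrite mul_diag_mx !mxE.
Qed.

Theorem theorem2 (C : numClosedFieldType) (d : nat) (hd : (2 <= d)%N)
    (P : 'M[C]_d.+1) (hP : diagonalizing P)
    (s : seq C) (hs : root_seq (limit_poly P) s) :
  size s = d.-1 /\
  perm_eq [seq mobius x | x <- extended_roots s] (extended_roots s).
Proof.
set v := row ord_max (invmx P).
have eig_v : v *m Lambda C d = (d`!)%:R *: v := last_row_eigen hP.
have limE : limit_poly P = reverse_poly v.
  by apply: eq_bigr => k _; rewrite mxE.
have eig_q := Lambda_eigen_binomial eig_v.
have vd : v 0 ord_max != 0.
  apply/eqP => vd0.
  (* An eigenpolynomial of degree below d is 0, but a row of an invertible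
     matrix is not. *)
  have q0 : rVpoly v = 0.
    apply: (eigen_binomial_eq0 hd eig_q); apply/leq_sizeP => j.
    rewrite leq_eqVlt => /orP[/eqP <-|ltdj].
      by rewrite (coef_rVpoly_ord v ord_max).
    by rewrite nth_default // (leq_trans (size_poly _ _)).
  have [_ uP _] := hP.
  have : v *m P = 0 by rewrite -[v]rVpolyK q0 linear0 mul0mx.
  rewrite -row_mul mulVmx // => /rowP/(_ ord_max).
  by rewrite !mxE eqxx => /eqP; rewrite oner_eq0.
have v0 := Lambda_eigen_coef0 hd eig_v.
pose j1 : 'I_d.+1 := inord 1.
have j1E : j1 = 1%N :> nat by rewrite inordK // ltnS ltnW.
have vj1 : v 0 j1 != 0.
  (* Positivity applies to the multiple of v whose last entry is 1. *)
  pose w := (v 0 ord_max)^-1 *: v.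
  have eig_w : w *m Lambda C d = (d`!)%:R *: w.
    by rewrite -scalemxAl eig_v scalerA mulrC -scalerA.
  have wd : 0 < w 0 ord_max by rewrite mxE mulVf.
  have := Lambda_eigen_coef1_gt0 hd eig_w j1E wd.
  by rewrite mxE => /lt0r_neq0; apply: contraNneq => ->; rewrite mulr0.
have [_ eq_p] := hs; rewrite limE in hs eq_p.
have sz_s : d = (size s).+1.
  have [p0 _] := hs; have := size_reverse_poly v0 j1E vj1; rewrite eq_p => <-.
  by rewrite size_scale ?lead_coef_eq0 // size_prod_XsubC.
split; first by rewrite sz_s.
have [eq_q s_neq0] := rVpoly_extended_roots v0 vd sz_s eq_p.
have nz x : x \in extended_roots s -> x != Some 0.
  rewrite inE => /orP[/eqP-> //|/mapP[z sz ->]].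
  by rewrite (inj_eq Some_inj); apply: contraNneq s_neq0 => <-.
pose r := [seq inv_coord x | x <- extended_roots s].
have sz_r : size r = d by rewrite /r /= !size_map sz_s.
have : perm_eq [seq -1 - x | x <- r] r.
  apply: (perm_reflected_roots vd); rewrite sz_r [X in v 0 _ *: X]big_map -eq_q.
  exact: (eigen_binomial_reflect hd eig_q (size_poly _ _)).
move/(perm_map (@of_inv_coord C)); rewrite /r -!map_comp.
congr perm_eq; last first.
  by rewrite -[RHS]map_id; apply/eq_in_map => x /nz/inv_coordK.
apply/eq_in_map => x /nz x0 /=.
by rewrite -inv_coord_mobius // inv_coordK // mobius_neq0.
Qed.
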